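(* Let $\mathfrak{a}\subseteq\mathfrak{b}$ be nonzero proper ideals in $\mathbb{Q}[x_1,\ldots,x_n]_{\mathfrak{m}}$, where $\mathfrak{m}=\langle x_1,\ldots,x_n\rangle$, with reductions modulo $p$ denoted $\mathfrak{a}_p,\mathfrak{b}_p\subseteq\mathbb{F}_p[x_1,\ldots,x_n]_{\mathfrak{m}_p}$, and set $$\lambda=\lim_{p\to\infty}\operatorname{c}^{\mathfrak{b}_p}(\mathfrak{a}_p)=\min\{t\in\mathbb{R}_{>0}:\mathcal{J}(\mathfrak{a}^t)\subseteq\mathfrak{b}\}.$$ If $\lambda>1$, then $\operatorname{crit}^{\mathfrak{b}_p}(\mathfrak{a}_p)=1$ for all $p\gg0$. Otherwise, $\lim_{p\to\infty}\operatorname{crit}^{\mathfrak{b}_p}(\mathfrak{a}_p)=\lambda$.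
   Context: Reduction modulo $p$: if an ideal $\mathfrak{d}$ of $\mathbb{Q}[x_1,\ldots,x_n]_{\mathfrak{m}}$ is generated by a set $\mathcal{B}$ of polynomials with integer coefficients, $\mathfrak{d}_p$ is the ideal generated by the image of $\mathcal{B}$ in $\mathbb{F}_p[x_1,\ldots,x_n]_{\mathfrak{m}_p}$, where $\mathfrak{m}_p=\langle x_1,\dots,x_n\rangle$ is the homogeneous maximal ideal of $\mathbb{F}_p[x_1,\ldots,x_n]$; any two choices of $\mathcal{B}$ give the same $\mathfrak{d}_p$ for $p\gg0$. Multiplier ideals: $\mathcal{J}(\mathfrak{a}^t)=\{h\in\mathbb{Q}[x_1,\ldots,x_n]_{\mathfrak{m}}:\operatorname{div}(\pi^*h)\ge tZ-K_\pi\}$, where $\pi:X\to\operatorname{Spec}(\mathbb{Q}[x_1,\ldots,x_n]_{\mathfrak{m}})$ is a log resolution of $\mathfrak{a}$ with relative canonical divisor $K_\pi$ and $\mathfrak{a}\cdot\mathcal{O}_X=\mathcal{O}_X(-Z)$. It is known that the limit of $F$-thresholds in the definition of $\lambda$ exists and equals the stated minimum. Let $S$ be an $F$-finite regular domain of characteristic $p$ (e.g. $\mathbb{F}_p[x_1,\ldots,x_n]_{\mathfrak{m}_p}$), and let $\mathfrak{c},\mathfrak{d}$ be nonzero proper ideals of $S$ with $\mathfrak{c}\subseteq\sqrt{\mathfrak{d}}$; let $q$ range over powers $p^e$, $e\ge 0$. Put $\mathfrak{c}^{[q]}=\langle f^q:f\in\mathfrak{c}\rangle$, and for $k\in\mathbb{N}$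 with base $p$ expansion $k=k_0+k_1p+\cdots+k_rp^r$, $\mathfrak{c}^{[k]}=\mathfrak{c}^{k_0}(\mathfrak{c}^{k_1})^{[p]}\cdots(\mathfrak{c}^{k_r})^{[p^r]}$ (with $\mathfrak{c}^0=S$). The $F$-threshold is $\operatorname{c}^{\mathfrak{d}}(\mathfrak{c})=\lim_{q\to\infty}\nu(q)/q=\sup_q\nu(q)/q$ with $\nu(q)=\max\{k\in\mathbb{N}:\mathfrak{c}^k\not\subseteq\mathfrak{d}^{[q]}\}$, and the critical exponent is $\operatorname{crit}^{\mathfrak{d}}(\mathfrak{c})=\lim_{q\to\infty}\mu(q)/q=\sup_q\mu(q)/q$ with $\mu(q)=\max\{k\in\mathbb{N}:\mathfrak{c}^{[k]}\not\subseteq\mathfrak{d}^{[q]}\}$. *)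

(* Defs.v *)
(* MathComp / MathComp-Analysis *)
From HB Require Import structures.
From mathcomp Require Import all_boot all_order all_algebra.
From mathcomp Require Import all_classical all_reals.
From mathcomp Require Import topology normedtype sequences.
(* The notations of mpoly clash with those of MathComp-Analysis; [mpoly n k] is
   the ring written {mpoly k[n]} in multinomials. *)
From mathcomp Require mpoly.
Export -(notations) mpoly.

Set Implicit Arguments.
Unset Strict Implicit.
Unset Printing Implicit Defensive.

Import GRing.Theory Num.Theory.
Export numFieldNormedType.Exports.

Local Open Scope classical_set_scope.
Local Open Scope ring_scope.

Section Ideals.
Variable S : comNzRingType.
Implicit Types I J B : set S.

Definition is_ideal I : Prop :=
  [/\ I 0, (forall x y, I x -> I y -> I (x + y))
    & (forall s x, I x -> I (s * x))].

Definition ideal_gen B : set S := smallest is_ideal B.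

Definition ideal_mul I J : set S :=
  ideal_gen [set z | exists x y, [/\ I x, J y & z = x * y]].

Definition ideal_pow I (k : nat) : set S := iter k (ideal_mul I) setT.

Definition frob_pow I (q : nat) : set S := ideal_gen [set f ^+ q | f in I].

(* I^[k]: [k %/ p ^ i %% p] is the i-th base p digit of k, and the top digit of
   k > 0 has index [trunc_log p k]. *)
Definition gen_frob_pow (p : nat) I (k : nat) : set S :=
  \big[ideal_mul/setT]_(i < (trunc_log p k).+1)
    frob_pow (ideal_pow I (k %/ p ^ i %% p)%N) (p ^ i)%N.

End Ideals.

(* The maximum of P; the value is 0 when P is empty or unbounded. *)
Definition natmax (P : set nat) : nat :=
  xget 0%N [set k | P k /\ forall j, P j -> (j <= k)%N].

Section Thresholds.
Variables (R : realType) (S : comNzRingType) (p : nat).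
Implicit Types c d : set S.

Definition nu c d (q : nat) : nat :=
  natmax [set k | ~ (ideal_pow c k `<=` frob_pow d q)].

Definition mu c d (q : nat) : nat :=
  natmax [set k | ~ (gen_frob_pow p c k `<=` frob_pow d q)].

(* c^d(c) *)
Definition Fthreshold d c : R :=
  limn (fun e : nat => (nu c d (p ^ e)%N)%:R / (p ^ e)%:R : R).

(* crit^d(c) *)
Definition crit d c : R :=
  limn (fun e : nat => (mu c d (p ^ e)%N)%:R / (p ^ e)%:R : R).

End Thresholds.

(* k[x_1, ..., x_n]_m, as a subring of the fraction field. *)
Section LocalRing.
Variables (k : fieldType) (n : nat).

Definition hmax : set (mpoly n k) :=
  ideal_gen (range (fun i : 'I_n => mpolyX k (mnm1 i))).

Lemma hmaxE (f : mpoly n k) : hmax f <-> mcoeff mnm0 f = 0.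
Proof.
split.
  pose J : set (mpoly n k) := [set g | mcoeff mnm0 g = 0].
  apply: (@smallest_sub _ (@is_ideal _) _ J).
    split; rewrite /J /=; first by rewrite raddf0.
      by move=> x y hx hy; rewrite raddfD /= hx hy addr0.
    by move=> s x hx; rewrite rmorphM /= hx mulr0.
  move=> _ [i _ <-]; rewrite /J /= mcoeffX.
  by case: eqP => // /(congr1 mdeg); rewrite mdeg1 mdeg0.
move=> f0 J [[J0 JD JM] XJ].
rewrite [f]mpolyE; apply: (big_ind J) => // m _.
have [->|m0] := eqVneq m mnm0; first by rewrite f0 scale0r.
have [i mi] : exists i, m i != 0%N.
  apply/existsP; apply: contraT; rewrite negb_exists => /forallP h.
  case/eqP: m0; apply/mnmP => i; rewrite mnm0E.
  by apply/eqP; rewrite -[_ == _]negbK h.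
have -> : m = mnm_add (mnm_sub m (mnm1 i)) (mnm1 i).
  by rewrite submK // lep1mP.
rewrite mpolyXD -mul_mpolyC mulrA.
by apply: JM; apply: XJ; exists i.
Qed.

Definition in_loc : {pred {fraction (mpoly n k)}} :=
  fun x => `[< exists f g, ~ hmax g /\ x = tofrac f / tofrac g >].

Fact hmaxN0 (g : mpoly n k) : ~ hmax g -> tofrac g != 0.
Proof.
by move=> h; rewrite tofrac_eq0; apply/eqP => g0; apply/h/hmaxE; rewrite g0 raddf0.
Qed.

Fact hmaxM (f g : mpoly n k) : ~ hmax f -> ~ hmax g -> ~ hmax (f * g).
Proof.
move=> hf hg /hmaxE; rewrite rmorphM /= => /eqP; rewrite mulf_eq0.
by case/orP => /eqP /hmaxE.
Qed.

Fact in_loc_subring : subring_closed in_loc.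
Proof.
split.
- apply/asboolP; exists 1, 1; split; last by rewrite divff // tofrac1 oner_neq0.
  by move/hmaxE; rewrite rmorph1; apply/eqP/oner_neq0.
- move=> _ _ /asboolP[f [g [hg ->]]] /asboolP[f' [g' [hg' ->]]].
  apply/asboolP; exists (f * g' - f' * g), (g * g'); split; first exact: hmaxM.
  rewrite -mulNr addf_div ?hmaxN0 // tofracM tofracB !tofracM mulNr.
  by [].
- move=> _ _ /asboolP[f [g [hg ->]]] /asboolP[f' [g' [hg' ->]]].
  apply/asboolP; exists (f * f'), (g * g'); split; first exact: hmaxM.
  by rewrite mulf_div !tofracM.
Qed.
HB.instance Definition _ := GRing.isSubringClosed.Build _ in_loc in_loc_subring.

Record local_ring := LocalRing {
  loc_val :> {fraction (mpoly n k)};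
  loc_valP : loc_val \in in_loc }.

HB.instance Definition _ := [isSub for loc_val].
HB.instance Definition _ := [Choice of local_ring by <:].
HB.instance Definition _ := [SubChoice_isSubComNzRing of local_ring by <:].

Fact poly_in_loc (f : mpoly n k) : tofrac f \in in_loc.
Proof.
apply/asboolP; exists f, 1; split; last by rewrite tofrac1 divr1.
by move/hmaxE; rewrite rmorph1; apply/eqP/oner_neq0.
Qed.

Definition poly_to_loc (f : mpoly n k) : local_ring := LocalRing (poly_in_loc f).

(* The ideal of k[x_1, ..., x_n]_m generated by the image of a set of
   polynomials with integer coefficients: for k = Q this is the ideal generated
   by B, and for k = 'F_p its reduction modulo p. *)
Definition int_ideal (B : set (mpoly n int)) : set local_ring :=
  ideal_gen [set poly_to_loc (map_mpoly intr f) | f in B].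

End LocalRing.

Arguments int_ideal k {n} B.

Definition primes_oo : set_system nat := within [set p | prime p] \oo.

(* c^{b_p}(a_p) and crit^{b_p}(a_p), where a and b are generated by the sets of
   integer polynomials A and B. *)
Definition Fthreshold_mod (R : realType) (n : nat) (A B : set (mpoly n int))
    (p : nat) : R :=
  Fthreshold R p (int_ideal 'F_p B) (int_ideal 'F_p A).

Definition crit_mod (R : realType) (n : nat) (A B : set (mpoly n int))
    (p : nat) : R :=
  crit R p (int_ideal 'F_p B) (int_ideal 'F_p A).

(* Main.v *)
(* For p >> 0 the reductions satisfy a_p <= b_p, and a_p has N generators with
   N independent of p, because Z[x_1, ..., x_n] is Noetherian.  A monomial of
   degree (k + N) q in the generators is divisible by the q-th power of one of
   degree k, so a_p^((k + N) q) <= (a_p^k)^[q]; summing over base p digits,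
   a_p^(k + N (1 + p + ... + p^(e-1))) <= a_p^[k] <= a_p^k for k < p^e.  With
   a_p^[p^e] <= b_p^[p^e] this gives, for q = p^e,
     min (q - 1, nu q - N (q - 1) / (p - 1)) <= mu q <= min (q - 1, nu q),
   hence min (1, c - N / (p - 1)) <= crit <= min (1, c) for c = c^{b_p}(a_p). *)
From HB Require Import structures.
Require Import Defs.
From mathcomp Require Import all_boot all_order all_algebra.
From mathcomp Require Import all_classical all_reals.
From mathcomp Require Import topology normedtype sequences.
From mathcomp Require Import zify ring lra.

Set Implicit Arguments.
Unset Strict Implicit.
Unset Printing Implicit Defensive.

Import Order.TTheory GRing.Theory Num.Theory.

Local Open Scope classical_set_scope.
Local Open Scope ring_scope.

(** * Arithmetic of ideals: products, powers and Frobenius powers *)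

Section IdealOperations.
Variable S : comNzRingType.
Implicit Types (A B I J K c d : set S) (x y : S).

Lemma ideal_genP B : is_ideal (ideal_gen B).
Proof.
split=> [I [[]]//|x y Bx By I hI|s x Bx I hI]; have [[_ hD hM] _] := hI.
  by apply: hD; [apply: Bx|apply: By].
by apply: hM; apply: Bx.
Qed.

Lemma sub_ideal_gen B : B `<=` ideal_gen B.
Proof. exact: sub_gen_smallest. Qed.

Lemma ideal_gen_min B I : is_ideal I -> B `<=` I -> ideal_gen B `<=` I.
Proof. exact: smallest_sub. Qed.

Lemma ideal_genS A B : A `<=` ideal_gen B -> ideal_gen A `<=` ideal_gen B.
Proof. by apply: ideal_gen_min; apply: ideal_genP. Qed.

Lemma idealMr I x y : is_ideal I -> I x -> I (x * y).
Proof. by move=> [_ _ IM] Ix; rewrite mulrC; apply: IM. Qed.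

Lemma is_idealT : is_ideal [set: S].
Proof. by []. Qed.

Lemma ideal_setT I : is_ideal I -> I 1 -> I = setT.
Proof.
by move=> [_ _ IM] I1; apply/seteqP; split=> // x _; rewrite -[x]mulr1; exact: IM.
Qed.

(** Bilinear induction: for fixed [x] the [y] with [J (x * y)] form an ideal, and likewise in [x],
    so products of generators suffice. *)
Lemma ideal_gen_mul_sub A B J : is_ideal J ->
  (forall x y, A x -> B y -> J (x * y)) ->
  forall x y, ideal_gen A x -> ideal_gen B y -> J (x * y).
Proof.
move=> [J0 JD JM] AB x y Ax By.
pose K1 := [set x' | forall y', B y' -> J (x' * y')].
have K1x : K1 x.
  apply: (@ideal_gen_min A K1) => // [|x' Ax' y' By']; last exact: AB.
  split=> [y' _|u v hu hv y' By'|s u hu y' By'].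
  - by rewrite mul0r.
  - by rewrite mulrDl; apply: JD; [apply: hu|apply: hv].
  - by rewrite -mulrA; apply: JM; apply: hu.
apply: (@ideal_gen_min B [set y' | J (x * y')]) => //.
split=> [|u v|s u] /=; first by rewrite mulr0.
  by rewrite mulrDr; apply: JD.
by rewrite mulrCA; apply: JM.
Qed.

Lemma ideal_mulP I J : is_ideal (ideal_mul I J).
Proof. exact: ideal_genP. Qed.

Lemma ideal_mul_in I J x y : I x -> J y -> ideal_mul I J (x * y).
Proof. by move=> Ix Jy; apply: sub_ideal_gen; exists x, y. Qed.

Lemma ideal_mul_sub I J K : is_ideal K ->
  (forall x y, I x -> J y -> K (x * y)) -> ideal_mul I J `<=` K.
Proof.
by move=> hK IJK; apply: ideal_gen_min => // _ [x [y [Ix Jy ->]]]; apply: IJK.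
Qed.

Lemma ideal_mul_subl I J : is_ideal I -> ideal_mul I J `<=` I.
Proof. by move=> hI; apply: ideal_mul_sub => // x y Ix _; apply: idealMr. Qed.

Lemma ideal_mul_subr I J : is_ideal J -> ideal_mul I J `<=` J.
Proof. by move=> hJ; apply: ideal_mul_sub => // x y _; case: hJ => _ _;
  apply. Qed.

Lemma ideal_mulS I I' J J' : I `<=` I' -> J `<=` J' ->
  ideal_mul I J `<=` ideal_mul I' J'.
Proof.
move=> II JJ; apply: ideal_mul_sub => [|x y Ix Jy]; first exact: ideal_mulP.
by apply: ideal_mul_in; [apply: II|apply: JJ].
Qed.

Lemma ideal_powP I k : is_ideal (ideal_pow I k).
Proof. by case: k => [|k]; [apply: is_idealT|apply: ideal_mulP]. Qed.

Lemma ideal_pow_in I k x : I x -> ideal_pow I k (x ^+ k).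
Proof.
by move=> Ix; elim: k => // k IHk; rewrite exprS; apply: ideal_mul_in.
Qed.

Lemma ideal_powM I j k x y :
  ideal_pow I j x -> ideal_pow I k y -> ideal_pow I (j + k) (x * y).
Proof.
move=> + Iy; elim: j x => [x _|j IHj x].
  by have [_ _] := ideal_powP I k; apply.
have [I0 ID IM] := ideal_powP I (j.+1 + k).
pose K := [set x | ideal_pow I (j.+1 + k) (x * y)].
apply: (@ideal_mul_sub I (ideal_pow I j) K) => [|u v Iu Iv].
  split=> [|u v|s u]; rewrite /K /= ?mul0r ?mulrDl -?mulrA //; first exact: ID.
  exact: IM.
by rewrite /K /= -mulrA; apply: ideal_mul_in => //; apply: IHj.
Qed.

Lemma ideal_powD I j k :
  ideal_pow I (j + k) `<=` ideal_mul (ideal_pow I j) (ideal_pow I k).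
Proof.
elim: j => [|j IHj] /=.
  by move=> x Ix; rewrite -[x]mul1r; apply: ideal_mul_in.
have [I0 ID IM] := ideal_mulP (ideal_pow I j.+1) (ideal_pow I k).
apply: ideal_mul_sub => // u v Iu /IHj.
pose K := [set v | ideal_mul (ideal_pow I j.+1) (ideal_pow I k) (u * v)].
move: v; apply: (@ideal_mul_sub _ _ K) => [|v w Iv Iw].
  split=> [|v w|s v]; rewrite /K /= ?mulr0 ?mulrDr // 1?mulrCA; first exact: ID.
  exact: IM.
by rewrite /K /= mulrA; apply: ideal_mul_in => //; apply: ideal_mul_in.
Qed.

Lemma ideal_pow_leq I j k : (j <= k)%N -> ideal_pow I k `<=` ideal_pow I j.
Proof.
move=> /subnKC <- x /ideal_powD; apply: ideal_mul_subl; exact: ideal_powP.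
Qed.

Lemma ideal_powXM I j k x : ideal_pow I j x -> ideal_pow I (j * k) (x ^+ k).
Proof.
move=> Ix; elim: k => [|k IHk]; first by rewrite muln0.
by rewrite exprS mulnS; apply: ideal_powM.
Qed.

Lemma frob_powP I q : is_ideal (frob_pow I q).
Proof. exact: ideal_genP. Qed.

Lemma frob_pow_in I q x : I x -> frob_pow I q (x ^+ q).
Proof. by move=> Ix; apply: sub_ideal_gen; exists x. Qed.

Lemma frob_pow_sub I q K : is_ideal K ->
  (forall x, I x -> K (x ^+ q)) -> frob_pow I q `<=` K.
Proof. by move=> hK IK; apply: ideal_gen_min => // _ [x Ix <-]; apply: IK. Qed.

Lemma frob_powS I J q : I `<=` J -> frob_pow I q `<=` frob_pow J q.
Proof.
move=> IJ; apply: frob_pow_sub; first exact: frob_powP.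
by move=> x /IJ; apply: frob_pow_in.
Qed.

Lemma frob_pow_sub_id I q : (0 < q)%N -> is_ideal I -> frob_pow I q `<=` I.
Proof.
move=> q0 hI; apply: frob_pow_sub => // x Ix.
by rewrite -(prednK q0) exprS; apply: idealMr.
Qed.

Lemma frob_pow_sub_pow I j q :
  frob_pow (ideal_pow I j) q `<=` ideal_pow I (j * q).
Proof.
by apply: frob_pow_sub => [|x]; [apply: ideal_powP|apply: ideal_powXM].
Qed.

Lemma frob_pow_mul I J q :
  ideal_mul (frob_pow I q) (frob_pow J q) `<=` frob_pow (ideal_mul I J) q.
Proof.
apply: ideal_mul_sub; first exact: frob_powP.
apply: ideal_gen_mul_sub; first exact: frob_powP.
move=> _ _ [x Ix <-] [y Jy <-]; rewrite -exprMn; apply: frob_pow_in.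
exact: ideal_mul_in.
Qed.

Lemma frob_powM I q r : frob_pow I (q * r) `<=` frob_pow (frob_pow I q) r.
Proof.
apply: frob_pow_sub; first exact: frob_powP.
by move=> x Ix; rewrite exprM; do 2!apply: frob_pow_in.
Qed.

(** In characteristic p the p-th power map is additive, so the elements whose p-th power lies in
    [frob_pow d (q * p)] form an ideal; it contains the generators of [frob_pow d q]. *)
Lemma frob_pow_pchar (p : nat) I d q : p \in [pchar S] ->
  I `<=` frob_pow d q -> frob_pow I p `<=` frob_pow d (q * p).
Proof.
move=> charp Id; have [d0 dD dM] := frob_powP d (q * p).
apply: frob_pow_sub => // x /Id; move: x.
apply: ideal_gen_min => [|_ [x dx <-] /=].
  split=> [|x y dx dy|s x dx] /=.
  - by rewrite expr0n; case: eqP (pcharf_prime charp) => // ->.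
  - by rewrite exprDn_pchar ?pnatE ?(pcharf_prime charp) //; apply: dD.
  - by rewrite exprMn; apply: dM.
by rewrite -exprM; apply: frob_pow_in.
Qed.

(** Reduces inclusions of powers to exponent vectors. By induction on [k], multiplying a monomial by
    [g i] raises its i-th exponent by one. *)
Lemma ideal_pow_monomials N (g : 'I_N -> S) k K : is_ideal K ->
  (forall u : 'I_N -> nat, (\sum_i u i)%N = k -> K (\prod_i g i ^+ u i)) ->
  ideal_pow (ideal_gen (range g)) k `<=` K.
Proof.
pose mon k := [set x | exists2 u : 'I_N -> nat,
  (\sum_i u i)%N = k & x = \prod_i g i ^+ u i].
move=> hK monK; suff: ideal_pow (ideal_gen (range g)) k `<=` ideal_gen (mon k).
  move=> /subset_trans; apply; apply: ideal_gen_min => // _ [u uk ->].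
  exact: monK.
move=> {K hK monK}; elim: k => [|k IHk].
  move=> x _; rewrite -[x]mulr1; have [_ _] := ideal_genP (mon 0%N); apply.
  by apply: sub_ideal_gen; exists (fun=> 0%N); rewrite big1.
apply: ideal_mul_sub => [|x y gx /IHk]; first exact: ideal_genP.
move: x y gx; apply: ideal_gen_mul_sub; first exact: ideal_genP.
move=> _ _ [i _ <-] [u uk ->]; apply: sub_ideal_gen.
exists (fun j => (j == i) + u j)%N.
  by rewrite big_split /= uk -big_mkcond big_pred1_eq.
under [in RHS]eq_bigr do rewrite exprD.
rewrite big_split /=; congr (_ * _).
by rewrite (bigD1 i) //= eqxx big1 ?mulr1 // => j /negPf ->.
Qed.

(** Divide each exponent of a monomial by [q]. The [N] remainders are less than [q], so the
    quotients sum to at least [k], and the monomial is a multiple of the q-th power of an element of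
    the k-th power. *)
Lemma ideal_pow_sub_frob N (g : 'I_N -> S) k q :
  ideal_pow (ideal_gen (range g)) ((k + N) * q) `<=`
  frob_pow (ideal_pow (ideal_gen (range g)) k) q.
Proof.
set c := ideal_gen (range g).
(* For [q = 0] the Frobenius power is the unit ideal, since it contains [0 ^+ 0 = 1]. *)
have [->|q0] := posnP q.
  move=> x _; rewrite -[x]mulr1; have [_ _] := frob_powP (ideal_pow c k) 0.
  by apply; rewrite -(expr0 0); apply: frob_pow_in; case: (ideal_powP c k).
apply: ideal_pow_monomials => [|u usum]; first exact: frob_powP.
under eq_bigr do rewrite (divn_eq (u _) q) exprD exprM.
rewrite big_split /= prodrXl; apply: (idealMr _ (frob_powP _ _)).
apply: frob_pow_in; apply: (@ideal_pow_leq _ _ (\sum_i (u i %/ q))%N).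
  rewrite -(leq_add2r N) -(leq_pmul2r q0) -usum mulnDl big_distrl /=.
  rewrite -[X in (X * q)%N]card_ord -sum_nat_const -big_split /=.
  by apply: leq_sum => i _; rewrite {1}(divn_eq (u i) q) leq_add2l ltnW ?ltn_mod.
apply: (big_rec2 (fun x m => ideal_pow c m x)) => // i m x _ cx.
by apply: ideal_powM => //; apply: ideal_pow_in; apply: sub_ideal_gen; exists i.
Qed.

End IdealOperations.

(** * Generalized Frobenius powers and base p digits *)

Section GeneralizedFrobeniusPowers.
Variables (S : comNzRingType) (p : nat).
Hypothesis p_prime : prime p.
Implicit Types (c d : set S) (k : nat).

Lemma sum_digits k r : (\sum_(i < r) (k %/ p ^ i %% p) * p ^ i)%N = (k %% p ^ r)%N.
Proof.
elim: r => [|r IHr]; first by rewrite big_ord0 modn1.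
rewrite big_ord_recr /= IHr expnS.
have pr : (0 < p ^ r)%N by rewrite expn_gt0 prime_gt0.
set K := (k %/ p ^ r)%N; set t := (_ + _)%N.
have -> : k = (K %/ p * (p * p ^ r) + t)%N.
  by rewrite {1}(divn_eq k (p ^ r)) -/K {1}(divn_eq K p) /t; ring.
rewrite modnMDl modn_small //.
apply: leq_trans (_ : (K %% p).+1 * p ^ r <= _)%N.
  by rewrite mulSn ltn_add2r ltn_mod.
by rewrite leq_pmul2r // ltn_mod prime_gt0.
Qed.

Lemma sum_digits_trunc_log k :
  (\sum_(i < (trunc_log p k).+1) (k %/ p ^ i %% p) * p ^ i)%N = k.
Proof. by rewrite sum_digits modn_small // trunc_log_ltn ?prime_gt1. Qed.

Lemma big_ideal_mulP r (F : 'I_r -> set S) :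
  is_ideal (\big[@ideal_mul S/setT]_(i < r) F i).
Proof.
by elim/big_rec: _ => // i I _ _; apply: ideal_mulP.
Qed.

Lemma big_ideal_mul_sub r (F : 'I_r -> set S) (j : 'I_r) :
  (forall i, is_ideal (F i)) -> \big[@ideal_mul S/setT]_(i < r) F i `<=` F j.
Proof.
move=> hF; elim: r F hF j => [|r IHr] F hF j; first by case: j.
rewrite big_ord_recl; case: (unliftP ord0 j) => [j'|] ->.
  apply: subset_trans (IHr (fun i => F (lift ord0 i)) _ j') => //.
  by apply: ideal_mul_subr; apply: big_ideal_mulP.
exact: ideal_mul_subl.
Qed.

Lemma gen_frob_pow_sub_pow c k : gen_frob_pow p c k `<=` ideal_pow c k.
Proof.
rewrite -[X in ideal_pow c X](sum_digits_trunc_log k) /gen_frob_pow.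
apply: (big_rec2 (fun I m => I `<=` ideal_pow c m)) => // i m I _ Im.
apply: ideal_mul_sub => [|x y /frob_pow_sub_pow cx /Im]; first exact: ideal_powP.
exact: ideal_powM.
Qed.

(** Every digit is raised by [N] before its power is traded for a Frobenius power, which costs
    [N * p ^ i] in the exponent at place [i]. *)
Lemma pow_sub_gen_frob_pow N (g : 'I_N -> S) k e : (0 < e)%N -> (k < p ^ e)%N ->
  ideal_pow (ideal_gen (range g)) (k + N * \sum_(i < e) p ^ i) `<=`
  gen_frob_pow p (ideal_gen (range g)) k.
Proof.
move=> e0 ke; set c := ideal_gen _; set r := (trunc_log p k).+1.
(* For [k = 0] the product still has one factor, so [r = 1]; this is where [0 < e] enters. *)
have re : (r <= e)%N.
  rewrite /r; have [->|k0] := posnP k; first by rewrite trunc_log0.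
  rewrite -(ltn_exp2l _ _ (prime_gt1 p_prime)).
  exact: leq_ltn_trans (trunc_logP (prime_gt1 p_prime) k0) ke.
pose m := (\sum_(i < r) (k %/ p ^ i %% p + N) * p ^ i)%N.
apply: subset_trans (_ : ideal_pow c m `<=` _).
  apply: ideal_pow_leq; rewrite /m.
  under eq_bigr do rewrite mulnDl.
  rewrite big_split /= sum_digits_trunc_log leq_add2l -big_distrr /= leq_mul2l.
  rewrite -(big_mkord predT (fun i => p ^ i)%N).
  rewrite -(big_mkord predT (fun i => p ^ i)%N) (big_cat_nat _ re) //=.
  by rewrite leq_addr orbT.
rewrite /m /gen_frob_pow -/r.
apply: (big_rec2 (fun m I => ideal_pow c m `<=` I)) => // i I j _ Ij.
apply: subset_trans (@ideal_powD _ c _ _) _; apply: ideal_mulS => //.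
exact: ideal_pow_sub_frob.
Qed.

(** The top digit of [k] is nonzero and sits at a place [r >= e], so its factor alone lies in
    [frob_pow d (p ^ e)]. This keeps [mu] below [q], and so the critical exponent at most 1. *)
Lemma gen_frob_pow_sub_frob c d k e : is_ideal c -> is_ideal d -> c `<=` d ->
  (p ^ e <= k)%N ->
  gen_frob_pow p c k `<=` frob_pow d (p ^ e).
Proof.
move=> hc hd cd ek; set r := trunc_log p k.
have p1 := prime_gt1 p_prime; have p0 := prime_gt0 p_prime.
have k0 : (0 < k)%N by apply: leq_trans ek; rewrite expn_gt0 p0.
have er : (e <= r)%N by apply: trunc_log_max.
apply: subset_trans (big_ideal_mul_sub ord_max _) _ => [i|/=].
  exact: frob_powP.
have /andP[rk kr] := trunc_log_bounds p1 k0.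
apply: frob_pow_sub => [|x]; first exact: frob_powP.
have dig : (0 < k %/ p ^ r %% p)%N.
  by rewrite modn_small ?divn_gt0 ?expn_gt0 ?p0 // ltn_divLR ?expn_gt0 ?p0 // -expnS.
move/(ideal_pow_leq dig) => /= /(ideal_mul_subl hc) /cd dx.
rewrite -/r -(subnK er) expnD exprM; apply: frob_pow_in.
apply: (frob_pow_sub_id (q := p ^ (r - e))) => //; first by rewrite expn_gt0 p0.
exact: frob_pow_in.
Qed.

Lemma gen_frob_pow01 c : gen_frob_pow p c 0 1.
Proof.
rewrite /gen_frob_pow; apply: (big_ind (fun I : set S => I 1)) => // [I J I1 J1|i _].
  by rewrite -[1]mulr1; apply: ideal_mul_in.
by rewrite div0n mod0n -(expr1n _ (p ^ i)); apply: frob_pow_in.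
Qed.

(** Dropping the lowest digit enlarges the ideal. The other digits of [k] are those of [k %/ p] one
    place higher, and this shift is a p-th Frobenius power. *)
Lemma gen_frob_pow_divn c k :
  gen_frob_pow p c k `<=` frob_pow (gen_frob_pow p c (k %/ p)) p.
Proof.
have p1 := prime_gt1 p_prime; have p0 := prime_gt0 p_prime.
have [kp|pk] := ltnP k p.
  rewrite (divn_small kp) => x _; rewrite -[x]mulr1.
  have [_ _] := frob_powP (gen_frob_pow p c 0) p; apply.
  by rewrite -(expr1n _ p); apply: frob_pow_in; apply: gen_frob_pow01.
have kp0 : (0 < k %/ p)%N by rewrite divn_gt0.
have tl : trunc_log p k = (trunc_log p (k %/ p)).+1.
  apply: trunc_log_eq => //; have /andP[h1 h2] := trunc_log_bounds p1 kp0.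
  by rewrite expnSr -leq_divRL // h1 /= expnSr -ltn_divLR.
rewrite /gen_frob_pow tl big_ord_recl.
apply: subset_trans (ideal_mul_subr _) _; first exact: big_ideal_mulP.
apply: (big_rec2 (fun I J => I `<=` frob_pow J p)) => [x _|i I J _ IJ].
  rewrite -[x]mulr1; have [_ _] := frob_powP [set: S] p; apply.
  by rewrite -(expr1n _ p); apply: frob_pow_in.
apply: subset_trans (@frob_pow_mul _ _ _ _); apply: ideal_mulS => //.
rewrite lift0 expnS divnMA mulnC; exact: frob_powM.
Qed.

End GeneralizedFrobeniusPowers.

(** * Comparison of [nu] and [mu] for a fixed prime *)

(** Non-emptiness and a bound ensure that [natmax] is a genuine maximum and not the default 0. *)
Lemma natmaxP (P : set nat) M : P 0%N -> (forall k, P k -> (k <= M)%N) ->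
  P (natmax P) /\ (forall k, P k -> (k <= natmax P)%N).
Proof.
move=> P0 PM; have exP : exists k, `[< P k >] by exists 0%N; apply/asboolP.
have PM' k : `[< P k >] -> (k <= M)%N by move=> /asboolP; apply: PM.
case: (ex_maxnP exP PM') => k /asboolP Pk kmax.
apply: (@xgetPex _ 0%N [set k | P k /\ forall j, P j -> (j <= k)%N]).
by exists k; split=> // j Pj; apply: kmax; apply/asboolP.
Qed.

Section ThresholdBounds.
Variables (S : comNzRingType) (p N : nat) (g : 'I_N -> S) (d : set S).
Hypotheses (p_prime : prime p) (charp : p \in [pchar S]) (d_ideal : is_ideal d).
Let c := ideal_gen (range g).
Hypotheses (cd : c `<=` d) (d1 : ~ d 1).

Let frobN1 e : ~ frob_pow d (p ^ e) 1.
Proof.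
by move/(frob_pow_sub_id _ d_ideal) => d1'; apply/d1/d1';
  rewrite expn_gt0 prime_gt0.
Qed.

Lemma nuP e (q := (p ^ e)%N) :
  ~ (ideal_pow c (nu c d q) `<=` frob_pow d q) /\
  (forall k, ~ (ideal_pow c k `<=` frob_pow d q) -> (k <= nu c d q)%N).
Proof.
(* The bound comes from [c^((1 + N) q) <= c^[q] <= d^[q]]. *)
apply: (@natmaxP _ ((1 + N) * q)) => [/(_ 1 I)|k]; first exact: frobN1.
apply: contraPT; rewrite -ltnNge => /ltnW /ideal_pow_leq h; apply.
apply: subset_trans (h _ _) _; apply: subset_trans (@ideal_pow_sub_frob _ _ _ _ _) _.
by apply: frob_powS => x /(ideal_mul_subl (ideal_genP _)) /cd.
Qed.

Lemma muP e (q := (p ^ e)%N) :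
  [/\ ~ (gen_frob_pow p c (mu p c d q) `<=` frob_pow d q),
      (forall k, ~ (gen_frob_pow p c k `<=` frob_pow d q) -> (k <= mu p c d q)%N)
    & (mu p c d q < q)%N].
Proof.
have bound k : ~ (gen_frob_pow p c k `<=` frob_pow d q) -> (k < q)%N.
  apply: contraPT; rewrite -leqNgt => qk; apply.
  by apply: gen_frob_pow_sub_frob => //; apply: ideal_genP.
have [|k /bound /ltnW //|mu1 mu2] := @natmaxP
    [set k | ~ (gen_frob_pow p c k `<=` frob_pow d q)] q.
  suff gen1 : gen_frob_pow p c 0 1 by move=> /(_ 1 gen1); apply: frobN1.
  exact: gen_frob_pow01.
by split=> //; apply: bound.
Qed.

(** With [q = p^e] and [k = nu c d q + 1] one has [c^k <= d^[q]], and applying Frobenius, [c^((k +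
    N) p) <= (c^k)^[p] <= d^[q p]]. *)
Lemma nu_expS e : (nu c d (p ^ e.+1) <= (nu c d (p ^ e) + N.+1) * p)%N.
Proof.
have [nuN _] := nuP e.+1; have [_ nu_max] := nuP e.
rewrite leqNgt; apply/negP => /ltnW /ideal_pow_leq lt_nu; apply: nuN.
apply: subset_trans (lt_nu _ _) _; rewrite addnS -addSn expnSr.
apply: subset_trans (@ideal_pow_sub_frob _ _ _ _ _) _;
  apply: frob_pow_pchar => //.
by apply: contrapT => /nu_max; rewrite ltnn.
Qed.

(** By [gen_frob_pow_divn] and Frobenius, an exponent admissible at level [e.+1] remains admissible
    at level [e] after division by [p]. *)
Lemma mu_expS e : (mu p c d (p ^ e.+1) < (mu p c d (p ^ e)).+1 * p)%N.
Proof.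
have [muN _ _] := muP e.+1; have [_ mu_max _] := muP e.
rewrite -ltn_divLR ?prime_gt0 // ltnS; apply: mu_max => muq; apply: muN.
apply: subset_trans (@gen_frob_pow_divn _ _ p_prime _ _) _.
rewrite [X in frob_pow d X]expnSr.
exact: (@frob_pow_pchar _ _ _ _ _ charp muq).
Qed.

Lemma mu_le_nu e : (mu p c d (p ^ e) <= nu c d (p ^ e))%N.
Proof.
have [muN _ _] := muP e; have [_ nu_max] := nuP e.
apply: nu_max; apply: contra_not muN; apply: subset_trans.
exact: gen_frob_pow_sub_pow.
Qed.

Lemma mu_ge e k : (0 < e)%N -> (k < p ^ e)%N ->
  (k + N * \sum_(i < e) p ^ i <= nu c d (p ^ e))%N -> (k <= mu p c d (p ^ e))%N.
Proof.
move=> e0 ke knu; have [_ mu_max _] := muP e; have [nuN _] := nuP e.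
apply: mu_max => kd; apply: nuN.
apply: subset_trans (ideal_pow_leq knu) _.
exact: subset_trans (@pow_sub_gen_frob_pow _ _ p_prime _ g _ _ e0 ke) kd.
Qed.

Variable R : realType.

(* x + 2 C / p^e is nonincreasing.  Using this for nu and mu instead of
   monotonicity avoids the flatness of Frobenius. *)
Lemma is_cvg_quasi_nonincreasing (x : R ^nat) (C : R) :
  0 <= C -> (forall e, 0 <= x e) ->
  (forall e, x e.+1 <= x e + C / (p ^ e)%:R) -> cvgn x.
Proof.
move=> C0 x0 xS; have p2 : 2%:R <= p%:R :> R by rewrite ler_nat prime_gt1.
have p0 : 0 < p%:R :> R by apply: lt_le_trans p2.
(* The factor 2 makes each drop of [z] at least [C / p ^ e], because [2 / p + 1 <= 2]. *)
pose z e : R := geometric (2 * C) p%:R^-1 e.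
have z0 e : 0 <= z e by rewrite /z /= !mulr_ge0 ?exprn_ge0 ?invr_ge0.
have cz : cvgn z.
  apply: cvgP; apply: cvg_geometric; rewrite ger0_norm ?invr_ge0 ?ltW //.
  by rewrite invf_lt1 //; apply: lt_le_trans p2; rewrite ltr1n.
have -> : x = (x \+ z) - z by apply/funext => e /=; rewrite !fctE addrK.
apply: is_cvgB => //; apply: nonincreasing_is_cvgn; last first.
  by exists 0 => _ [e _ <-] /=; rewrite addr_ge0.
apply/nonincreasing_seqP => e /=.
have zS : z e.+1 + C / (p ^ e)%:R <= z e.
  rewrite /z /= exprS natrX exprVn.
  have Cp : 0 <= C / p%:R ^+ e by rewrite divr_ge0 ?exprn_ge0.
  have le_half : p%:R^-1 <= 2^-1 :> R by rewrite lef_pV2 ?posrE.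
  have := ler_wpM2r Cp le_half; rewrite -!mulrA [_^-1 * (C / _)]mulrCA; lra.
by have := xS e; lra.
Qed.

Let pe_gt0 e : 0 < (p ^ e)%:R :> R.
Proof. by rewrite ltr0n expn_gt0 prime_gt0. Qed.

(** [limn] is a limit only for convergent sequences, so convergence must precede any comparison of
    thresholds. By [nu_expS] one step raises the quotient by at most [(N + 1) / p ^ e]. *)
Lemma is_cvg_nu : cvgn (fun e => (nu c d (p ^ e))%:R / (p ^ e)%:R : R).
Proof.
apply: (@is_cvg_quasi_nonincreasing _ N.+1%:R) => // [e|e].
  by rewrite divr_ge0.
rewrite -mulrDl -natrD ler_pdivrMr // mulrAC ler_pdivlMr // -!natrM ler_nat.
by rewrite [X in (_ <= _ * X)%N]expnSr mulnCA [leqLHS]mulnC leq_mul2l nu_expS orbT.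
Qed.

Lemma is_cvg_mu : cvgn (fun e => (mu p c d (p ^ e))%:R / (p ^ e)%:R : R).
Proof.
apply: (@is_cvg_quasi_nonincreasing _ 1) => // [e|e].
  by rewrite divr_ge0.
rewrite -mulrDl -(natrD _ _ 1) ler_pdivrMr // mulrAC ler_pdivlMr // -!natrM.
rewrite ler_nat addn1 [X in (_ <= _ * X)%N]expnSr mulnCA [leqLHS]mulnC leq_mul2l.
by rewrite ltnW ?orbT // mu_expS.
Qed.

Lemma crit_le_Fthreshold : crit R p d c <= Fthreshold R p d c.
Proof.
apply: ler_lim; [exact: is_cvg_mu|exact: is_cvg_nu|].
by near=> e; rewrite ler_pM2r ?invr_gt0 // ler_nat mu_le_nu.
Unshelve. all: by end_near. Qed.

Lemma crit_le1 : crit R p d c <= 1.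
Proof.
apply: limr_le; first exact: is_cvg_mu.
near=> e; rewrite ler_pdivrMr // mul1r ler_nat ltnW //.
by have [] := muP e.
Unshelve. all: by end_near. Qed.

(** A number [h] strictly between crit and [min (1, c - N / (p - 1))] is refuted at a large level
    [e], where [mu_ge] applies to an exponent that is at least [h * p ^ e]. *)
Lemma crit_ge : 1 <= crit R p d c \/
  Fthreshold R p d c - N%:R / (p.-1)%:R <= crit R p d c.
Proof.
set s := crit R p d c; set t := Fthreshold R p d c; set D := _ / _.
have [|s1] := leP 1 s; [by left|right]; rewrite leNgt; apply/negP => st.
pose m := Num.min 1 (t - D); have sm : s < m by rewrite lt_min s1.
pose h := (s + m) / 2; have [sh hm] : s < h /\ h < m by rewrite /h; split; lra.
have [h1 ht] : h < 1 /\ h + D < t.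
  by move: hm; rewrite /m lt_min => /andP[? ?]; split=> //; lra.
(* The last condition gives [h * p ^ e <= p ^ e - 1], so the cap [k < p ^ e] in [mu_ge] does no
   harm. *)
have [e [e0 mu_lt nu_gt pe]] : exists e, [/\ (0 < e)%N,
    (mu p c d (p ^ e))%:R / (p ^ e)%:R < h,
    h + D < (nu c d (p ^ e))%:R / (p ^ e)%:R & (1 - h)^-1 < (p ^ e)%:R ].
  apply: (@filter_ex _ \oo); near=> e; split.
  - near: e; exact: nbhs_infty_gt.
  - near: e; apply: (cvgr_lt _ is_cvg_mu); exact: sh.
  - near: e; apply: (cvgr_gt _ is_cvg_nu); exact: ht.
  - apply: (@lt_trans _ _ e%:R); last by rewrite ltr_nat ltn_expl ?prime_gt1.
    near: e; exact: nbhs_infty_gtr.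
have q0 := pe_gt0 e; have q0' : (0 < p ^ e)%N by rewrite expn_gt0 prime_gt0.
have sumE : (p.-1%:R * (\sum_(i < e) p ^ i)%N%:R = (p ^ e)%:R - 1 :> R).
  by rewrite -natrM -predn_exp -subn1 natrB.
have p1 : 0 < p.-1%:R :> R by rewrite ltr0n -ltnS prednK ?prime_gt0 ?prime_gt1.
set sg := (\sum_(i < e) p ^ i)%N in sumE.
(* The geometric sum gives [N * sg = D * (p ^ e - 1)]. *)
have Nsg : (N * sg)%:R <= D * (p ^ e)%:R.
  rewrite /D mulrAC ler_pdivlMr // natrM -mulrA ler_wpM2l //.
  by rewrite mulrC sumE lerBlDr lerDl.
move: mu_lt nu_gt; rewrite ltr_pdivrMr // ltr_pdivlMr // => mu_lt nu_gt.
pose k := minn (p ^ e).-1 (nu c d (p ^ e) - N * sg).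
(* This makes the truncated subtraction in [k] exact. *)
have Nnu : (N * sg <= nu c d (p ^ e))%N.
  have h0 : 0 <= h by rewrite ltW // (le_lt_trans _ sh) // limr_ge //;
    [exact: is_cvg_mu|near=> e'; rewrite divr_ge0].
  rewrite -(ler_nat R) (le_trans Nsg) // (le_trans _ (ltW nu_gt)) //.
  by rewrite ler_pM2r // lerDr.
have : (k <= mu p c d (p ^ e))%N.
  apply: (mu_ge e0); first by rewrite -(prednK q0') ltnS geq_minl.
  by rewrite -(subnK Nnu) leq_add2r geq_minr.
rewrite -(ler_nat R) => /le_lt_trans/(_ mu_lt); rewrite ltNge => /negP; apply.
rewrite /k /minn; case: ifP => _.
  rewrite -subn1 natrB // lerBrDr -lerBrDl -[X in X - _]mul1r -mulrBl.
  by rewrite -ler_pdivrMl ?subr_gt0 // mulr1 ltW.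
by rewrite natrB // lerBrDr (le_trans _ (ltW nu_gt)) // mulrDl lerD2l.
Unshelve. all: by end_near. Qed.

End ThresholdBounds.

(** * Noetherian rings and Hilbert's basis theorem *)

Definition noetherian (S : comNzRingType) := forall I : set S, is_ideal I ->
  exists2 s : seq S, [set` s] `<=` I & I `<=` ideal_gen [set` s].

Lemma ideal_gen_morph (S T : comNzRingType) (f : {rmorphism S -> T}) A B :
  (forall x, A x -> ideal_gen B (f x)) ->
  forall x, ideal_gen A x -> ideal_gen B (f x).
Proof.
move=> AB x; have [B0 BD BM] := ideal_genP B.
apply: (@ideal_gen_min _ A (f @^-1` ideal_gen B)) => //.
split=> [|u v|s u] /=; first by rewrite rmorph0.
  by rewrite rmorphD; apply: BD.
by rewrite rmorphM; apply: BM.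
Qed.

Lemma ideal_gen_finite (S : comNzRingType) (B : set S) x : ideal_gen B x ->
  exists2 s : seq S, [set` s] `<=` B & ideal_gen [set` s] x.
Proof.
move: x; apply: ideal_gen_min => [|x Bx]; last first.
  exists [:: x] => [y /=|]; first by rewrite inE => /eqP ->.
  by apply: sub_ideal_gen; rewrite /= inE.
split=> [|x y [s sB sx] [t tB ty]|a x [s sB sx]].
- by exists [::] => //; case: (ideal_genP [set` ([::] : seq S)]).
- exists (s ++ t) => [z /=|].
    by rewrite mem_cat => /orP[/sB|/tB].
  have [_ stD _] := ideal_genP [set` s ++ t]; apply: stD.
    by move: x sx; apply: ideal_genS => z zs; apply: sub_ideal_gen;
      rewrite /= mem_cat [z \in s]zs.
  by move: y ty; apply: ideal_genS => z zt; apply: sub_ideal_gen;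
    rewrite /= mem_cat [z \in t]zt orbT.
- by exists s => //; case: (ideal_genP [set` s]) => _ _; apply.
Qed.

(** Each of finitely many generators of the ideal involves only finitely many elements of [B], so a
    finite part of [B] generates. For integer polynomials its size is the [N] that serves all primes
    at once. *)
Lemma noetherian_generators (S : comNzRingType) (B : set S) : noetherian S ->
  exists2 s : seq S, [set` s] `<=` B & B `<=` ideal_gen [set` s].
Proof.
move=> /(_ _ (ideal_genP B))[t tB Bt].
suff [s sB ts] : exists2 s : seq S,
    [set` s] `<=` B & [set` t] `<=` ideal_gen [set` s].
  exists s => // x /sub_ideal_gen /Bt; exact: ideal_genS.
elim: t tB {Bt} => [|x t IHt] xtB; first by exists [::].
have [|s sB ts] := IHt; first by move=> y yt; apply: xtB;
  rewrite /= inE [y \in t]yt orbT.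
have [|r rB xr] := @ideal_gen_finite _ B x;
  first by apply: xtB; rewrite /= inE eqxx.
exists (r ++ s) => [z /=|z /=]; first by rewrite mem_cat => /orP[/rB|/sB].
rewrite inE => /orP[/eqP ->|/ts].
  by move: x xr {IHt xtB}; apply: ideal_genS => y yr; apply: sub_ideal_gen;
    rewrite /= mem_cat [y \in r]yr.
by move: z; apply: ideal_genS => y ys; apply: sub_ideal_gen;
  rewrite /= mem_cat [y \in s]ys orbT.
Qed.

Lemma noetherian_surj (S T : comNzRingType) (f : {rmorphism S -> T}) :
  (forall y, exists x, f x = y) -> noetherian S -> noetherian T.
Proof.
move=> f_surj noethS J [J0 JD JM].
have [|s sJ Js] := noethS (f @^-1` J).
  split=> [|u v|r u] /=; first by rewrite rmorph0.
    by rewrite rmorphD; apply: JD.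
  by rewrite rmorphM; apply: JM.
exists (map f s) => [_ /= /mapP[x /sJ Jx ->] //|y Jy].
have [x fx] := f_surj y; rewrite -fx; apply: (ideal_gen_morph (A := [set` s])).
  by move=> z zs; apply: sub_ideal_gen; rewrite /= map_f.
by apply: Js; rewrite /= fx.
Qed.

(** By division with remainder, the least positive element generates a nonzero ideal. *)
Lemma noetherian_int : noetherian int.
Proof.
move=> I [I0 ID IM].
have [nz|z] := pselect (exists x, I x /\ x != 0); last first.
  exists [::] => // x Ix; have [->|x0] := eqVneq x 0; last by case: z; exists x.
  by case: (ideal_genP [set` ([::] : seq int)]).
have exd : exists n, `[< I n%:Z /\ (0 < n)%N >].
  have [x [Ix x0]] := nz; exists `|x|%N; apply/asboolP; split;
    last by rewrite absz_gt0.
  by rewrite abszE normrEsign; apply: IM.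
case: (ex_minnP exd) => m /asboolP[Im m0] mmin.
exists [:: m%:Z] => [x /=|x Ix]; first by rewrite inE => /eqP ->.
have Ir : I (x %% m%:Z)%Z.
  by rewrite /modz -mulNr; apply: ID => //; apply: IM.
have -> : x = (x %/ m%:Z)%Z * m%:Z.
  suff r0 : (x %% m%:Z)%Z = 0 by rewrite {1}(divz_eq x m%:Z) r0 addr0.
  apply/eqP/contraT => r0.
  have rge : 0 <= (x %% m%:Z)%Z by rewrite modz_ge0 // eqz_nat -lt0n.
  have := mmin `|(x %% m%:Z)%Z|%N; rewrite -ltz_nat gez0_abs //.
  have /mmin : `[< I `|(x %% m%:Z)%Z|%N%:Z /\ (0 < `|(x %% m%:Z)%Z|)%N >].
    by apply/asboolP; rewrite gez0_abs // absz_gt0.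
  by rewrite -lez_nat gez0_abs // leNgt ltz_pmod.
have [_ _ gM] := ideal_genP [set` [:: m%:Z]]; apply: gM.
by apply: sub_ideal_gen; rewrite /= inE.
Qed.

Section HilbertBasis.
Variables (R : comNzRingType).
Hypothesis noethR : noetherian R.

(** Elements of [I] whose leading coefficients generate [L d], for each [d <= D], suffice to cancel
    the leading term of any element of [I]; induction on the size then finishes. *)
Theorem Hilbert_basis : noetherian {poly R}.
Proof.
move=> I hI; have [I0 ID IM] := hI.
(* The ideals of coefficients of 'X^d stabilize. *)
pose L d := [set c | exists f : {poly R}, [/\ I f, (size f <= d.+1)%N & f`_d = c]].
have hL d : is_ideal (L d).
  split=> [|_ _ [f [If sf <-]] [g [Ig sg <-]]|a _ [f [If sf <-]]].
  - by exists 0; rewrite size_poly0 coef0.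
  - exists (f + g); rewrite coefD; split=> //; first exact: ID.
    by rewrite (leq_trans (size_polyD _ _)) // geq_max sf.
  - exists (a%:P * f); rewrite coefCM; split=> //; first exact: IM.
    by rewrite mul_polyC (leq_trans (size_scale_leq _ _)).
have LS d e : (d <= e)%N -> L d `<=` L e.
  move=> de _ [f [If sf <-]]; exists ('X^(e - d) * f); split; first exact: IM.
    by rewrite (leq_trans (size_polyMleq _ _)) // size_polyXn; lia.
  by rewrite coefXnM ltnNge leq_subr /= subKn.
have hU : is_ideal (\bigcup_d L d).
  split=> [|x y [d _ dx] [e _ ey]|a x [d _ dx]].
  - by exists 0%N => //; case: (hL 0%N).
  - have [_ LD _] := hL (maxn d e); exists (maxn d e) => //.
    apply: LD; first by apply: LS dx; exact: leq_maxl.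
    by apply: LS ey; exact: leq_maxr.
  - by exists d => //; case: (hL d) => _ _; apply.
(* The increasing union of the [L d] is finitely generated, and its generators already lie in one
   [L D]. *)
have [D LD] : exists D, forall d, L d `<=` L D.
  have [s sL Ls] := noethR hU.
  have [D sD] : exists D, [set` s] `<=` L D.
    elim: s sL {Ls} => [|x s IHs] xsL; first by exists 0%N.
    have [|D sD] := IHs; first by move=> y ys; apply: xsL;
      rewrite /= inE [y \in s]ys orbT.
    have [|d _ dx] := xsL x; first by rewrite /= inE eqxx.
    exists (maxn d D) => y /=; rewrite inE => /orP[/eqP ->|/sD].
      by apply: LS dx; exact: leq_maxl.
    by apply: LS; exact: leq_maxr.
  exists D => d x dx; have /Ls : (\bigcup_d L d) x by exists d.
  exact: ideal_gen_min.
have /choice[t tP] d : exists t : seq {poly R},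
    (forall f, f \in t -> I f /\ (size f <= d.+1)%N) /\
    L d `<=` ideal_gen [set` [seq (f : {poly R})`_d | f <- t]].
  have [s sL Ls] := noethR (hL d).
  suff [t [tI ts]] : exists t : seq {poly R},
      (forall f, f \in t -> I f /\ (size f <= d.+1)%N) /\
      [seq (f : {poly R})`_d | f <- t] = s by exists t; rewrite ts.
  elim: s sL {Ls} => [|x s IHs] xsL; first by exists [::].
  have [|t [tI <-]] := IHs; first by move=> y ys; apply: xsL;
    rewrite /= inE [y \in s]ys orbT.
  have [|f [If sf <-]] := xsL x; first by rewrite /= inE eqxx.
  by exists (f :: t); split=> // h; rewrite inE => /orP[/eqP ->|/tI].
pose T := flatten [seq t d | d <- iota 0 D.+1].
have T_I : [set` T] `<=` I.
  by move=> f /= /flattenP[_ /mapP[d _ ->]]; case: (tP d) => + _ => /[apply] -[].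
exists T => //; set J := ideal_gen _; have [J0 JD JM] := ideal_genP [set` T].
(* The size bound survives because elements of [t d] are only multiplied by constants. *)
have lift_coef d c : (d <= D)%N -> L d c ->
    exists g : {poly R}, [/\ J g, (size g <= d.+1)%N & g`_d = c].
  move=> dD; have [td] := tP d; move=> /[apply].
  move: c; apply: ideal_gen_min => [|_ /= /mapP[f ft ->]].
    split=> [|_ _ [f [Jf sf <-]] [g [Jg sg <-]]|a _ [f [Jf sf <-]]].
    - by exists 0; rewrite size_poly0 coef0.
    - exists (f + g); rewrite coefD; split=> //; first exact: JD.
      by rewrite (leq_trans (size_polyD _ _)) // geq_max sf.
    - exists (a%:P * f); rewrite coefCM; split=> //; first exact: JM.
      by rewrite mul_polyC (leq_trans (size_scale_leq _ _)).
  exists f; split=> //; last by case: (td f ft).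
  apply: sub_ideal_gen; apply/flattenP; exists (t d) => //.
  by rewrite map_f // mem_iota.
move=> f; have [m] := ubnP (size f); elim: m f => // m IHm f sf If.
have [->|f0] := eqVneq f 0; first exact: J0.
pose d := (size f).-1; have sfd : size f = d.+1 by rewrite prednK // size_poly_gt0.
(* Above degree [D] a coefficient is realized in degree [D], and the factor ['X^(d - e)] restores
   the degree. *)
pose e := minn d D.
have Le : L e f`_d.
  have Ld : L d f`_d by exists f; rewrite sfd.
  by rewrite /e; case: (leqP d D) => _ //; apply: LD Ld.
have [g [Jg sg gd]] := lift_coef e f`_d (geq_minr _ _) Le.
pose h := 'X^(d - e) * g; have Jh : J h by apply: JM.
have ed : (e <= d)%N by apply: geq_minl.
have Ih : I h by move: h Jh; apply: ideal_gen_min.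
rewrite -[f](subrK h) addrC; apply: (JD) => //; apply: IHm; last first.
  by apply: ID => //; rewrite -mulN1r; apply: IM.
rewrite ltnS in sf; apply: leq_trans sf; rewrite sfd ltnS.
apply/leq_sizeP => j; rewrite leq_eqVlt => /orP[/eqP <-|dj].
  by rewrite coefB /h coefXnM ltnNge leq_subr /= subKn // gd subrr.
rewrite coefB !nth_default ?subrr ?sfd // (leq_trans (size_polyMleq _ _)) //.
by rewrite size_polyXn (leq_trans _ dj) // -[in d.+1](subnK ed) -addnS leq_add2l.
Qed.

End HilbertBasis.

(** Variables are adjoined one at a time: [mpoly n.+1 R] is a quotient of [{poly mpoly n R}], with
    ['X] sent to the last variable. *)
Lemma noetherian_mpoly (R : comNzRingType) n :
  noetherian R -> noetherian (mpoly n R).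
Proof.
move=> noethR; elim: n => [|n /Hilbert_basis].
  apply: (@noetherian_surj _ _ (@mpolyC 0 R)) => // f.
  by exists (mcoeff mnm0 f); apply/esym/nvar0_mpolyC.
pose X i : mpoly n.+1 R := mpolyX R (mnm1 i).
pose ev : {rmorphism {poly mpoly n R} -> mpoly n.+1 R} :=
  horner_eval (X ord_max) \o map_poly (@mwiden n R).
apply: (@noetherian_surj _ _ ev) => f.
have /choice[x xE] i : exists x, ev x = X i.
  have [lt_in|] := ltnP i n; last first.
    move=> ni; exists 'X; rewrite /ev /= /horner_eval map_polyX hornerX.
    by congr X; apply/val_inj/anti_leq; rewrite /= ni -ltnS ltn_ord.
  exists (mpolyX R (mnm1 (Ordinal lt_in)))%:P.
  rewrite /ev /= /horner_eval map_polyC hornerC /= mwidenX mnmwiden1.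
  by rewrite /X; congr (mpolyX R (mnm1 _)); apply/val_inj.
exists (\sum_(m <- msupp f) (mpolyC n (mcoeff m f))%:P * \prod_i x i ^+ m i).
rewrite rmorph_sum [RHS]mpolyE; apply: eq_bigr => m _.
rewrite rmorphM rmorph_prod /= /horner_eval map_polyC hornerC /= mwidenC.
rewrite mul_mpolyC mpolyXE_id; congr (_ *: _); apply: eq_bigr => i _.
by rewrite -/(horner_eval _ _) -[LHS]/(ev _) rmorphXn xE.
Qed.

(** * The local ring and its ideals generated by integer polynomials *)

Section PolyToLoc.
Variables (k : fieldType) (n : nat).

Fact poly_to_loc_is_zmod_morphism : zmod_morphism (@poly_to_loc k n).
Proof. by move=> f g; apply: val_inj; rewrite /= tofracB. Qed.

Fact poly_to_loc_is_monoid_morphism : monoid_morphism (@poly_to_loc k n).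
Proof.
by split=> [|f g]; apply: val_inj; rewrite /= ?tofrac1 // tofracM.
Qed.

HB.instance Definition _ := GRing.isZmodMorphism.Build
  (mpoly n k) (local_ring k n) (@poly_to_loc k n) poly_to_loc_is_zmod_morphism.
HB.instance Definition _ := GRing.isMonoidMorphism.Build
  (mpoly n k) (local_ring k n) (@poly_to_loc k n) poly_to_loc_is_monoid_morphism.

Lemma poly_to_loc_inj : injective (@poly_to_loc k n).
Proof. by move=> f g /(congr1 (@loc_val k n)) /= /eqP;
  rewrite tofrac_eq => /eqP. Qed.

Lemma loc_fraction (x : local_ring k n) :
  exists f g, ~ hmax g /\ x * poly_to_loc g = poly_to_loc f.
Proof.
case: x => x xP; have /asboolP[f [g [hg xE]]] := xP; exists f, g; split=> //.
by apply: val_inj; rewrite /= xE divfK // hmaxN0.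
Qed.

Lemma poly_to_loc_unit g : ~ hmax g -> exists w, w * poly_to_loc g = 1 :> local_ring k n.
Proof.
move=> hg; have inv_in : (tofrac g)^-1 \in @in_loc k n.
  apply/asboolP; exists 1, g; split=> //; by rewrite tofrac1 div1r.
by exists (LocalRing inv_in); apply: val_inj; rewrite /= mulVf // hmaxN0.
Qed.

Definition int_to_loc : {rmorphism mpoly n int -> local_ring k n} :=
  (@poly_to_loc k n) \o map_mpoly intr.

Lemma hmax_map_intr f :
  hmax (map_mpoly intr f : mpoly n k) <-> (mcoeff mnm0 f)%:~R = 0 :> k.
Proof. by rewrite hmaxE mcoeff_map_mpoly. Qed.

(** One list of generators serves every field [k]; indexing it by ordinals gives the shape [range g]
    of the threshold bounds. *)
Lemma int_ideal_generators (B : set (mpoly n int)) (s : seq (mpoly n int)) :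
  [set` s] `<=` B -> B `<=` ideal_gen [set` s] ->
  int_ideal k B = ideal_gen (range (fun i : 'I_(size s) => int_to_loc s`_i)).
Proof.
move=> sB Bs; apply/seteqP; split; apply: ideal_genS => _ [f Bf <-].
  apply: (ideal_gen_morph (f := int_to_loc) (A := [set` s])); last exact: Bs.
  move=> h hs; apply: sub_ideal_gen.
  have hi : (index h s < size s)%N by rewrite index_mem.
  by exists (Ordinal hi); rewrite //= nth_index.
by apply: sub_ideal_gen; exists s`_f => //; apply: sB; apply: mem_nth.
Qed.

(** The generators lie in the maximal ideal, described by [M] as the fractions with numerator in
    [hmax], and 1 does not. *)
Lemma int_ideal_proper (B : set (mpoly n int)) :
  (forall f, B f -> mcoeff mnm0 f = 0) -> ~ int_ideal k B 1.
Proof.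
move=> B0; pose M := [set x : local_ring k n |
  exists f g, [/\ hmax f, ~ hmax g & x * poly_to_loc g = poly_to_loc f]].
have [h0 hD hM] := ideal_genP (range (fun i : 'I_n => mpolyX k (mnm1 i))).
suff BM : int_ideal k B `<=` M.
  by move=> /BM[f [g [hf hg]]];
    rewrite mul1r => /poly_to_loc_inj fg; case: hg; rewrite fg.
apply: ideal_gen_min => [|_ [f /B0 f0 <-]]; last first.
  exists (map_mpoly intr f), 1; split; last by rewrite rmorph1 mulr1.
    by apply/hmax_map_intr; rewrite f0.
  by move/hmaxE; rewrite rmorph1; apply/eqP/oner_neq0.
split=> [|x y [f [g [hf hg xE]]] [f' [g' [hf' hg' yE]]]|s x [f [g [hf hg xE]]]].
- exists 0, 1; split=> //; last by rewrite mul0r rmorph0.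
  by move/hmaxE; rewrite rmorph1; apply/eqP/oner_neq0.
- exists (g' * f + g * f'), (g * g'); split; last 1 first.
  + by rewrite rmorphD !rmorphM /= -xE -yE; ring.
  + by apply: hD; apply: hM.
  + exact: hmaxM.
- have [u [v [hv sE]]] := loc_fraction s.
  exists (u * f), (v * g); split; first exact: hM; first exact: hmaxM.
  by rewrite !rmorphM /= -xE -sE; ring.
Qed.

End PolyToLoc.

(** A generator with nonzero constant term would be a unit over the rationals. Vanishing constant
    terms persist modulo every prime and keep the reductions proper. *)
Lemma int_ideal_coeff0 n (B : set (mpoly n int)) : int_ideal rat B <> setT ->
  forall f, B f -> mcoeff mnm0 f = 0.
Proof.
move=> BT f Bf; apply/eqP/contraT => f0; case: BT.
have hB : is_ideal (int_ideal rat B) by apply: ideal_genP.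
apply: ideal_setT => //; have [|w <-] :=
  @poly_to_loc_unit rat n (map_mpoly intr f).
  by move/hmax_map_intr/eqP; rewrite intr_eq0; apply/negP.
by have [_ _] := hB; apply; apply: sub_ideal_gen; exists f.
Qed.

(** * Clearing denominators and reduction modulo p *)

Lemma rat_mpoly_denominator n (u : mpoly n rat) :
  exists (D : int) U, D != 0 /\ u * mpolyC n D%:~R = map_mpoly intr U.
Proof.
elim/mpolyind: u => [|c m u _ _ [D [U [D0 uE]]]].
  by exists 1, 0; rewrite mul0r rmorph0.
exists (denq c * D), (mpolyC n (numq c * D) * mpolyX int m + mpolyC n (denq c) * U).
split; first by rewrite mulf_neq0 ?denq_eq0.
have -> : map_mpoly intr
    (mpolyC n (numq c * D) * mpolyX int m + mpolyC n (denq c) * U) =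
    mpolyC n (numq c)%:~R * mpolyC n D%:~R * mpolyX rat m +
    mpolyC n (denq c)%:~R * map_mpoly intr U.
  by rewrite rmorphD !rmorphM /= !map_mpolyC map_mpolyX.
have -> : mpolyC n (numq c)%:~R = mpolyC n c * mpolyC n (denq c)%:~R.
  by rewrite -rmorphM -numqE.
by rewrite -uE -mul_mpolyC intrM mpolyCM; ring.
Qed.

(** Scaling numerator and denominator by both common denominators makes them integral and keeps the
    constant term of the denominator nonzero. *)
Lemma loc_int_fraction n (x : local_ring rat n) :
  exists f g, mcoeff mnm0 g != 0 /\ x * int_to_loc rat n g = int_to_loc rat n f.
Proof.
have [u [v [hv xE]]] := loc_fraction x.
have [D [U [D0 uE]]] := rat_mpoly_denominator u.
have [E [V [E0 vE]]] := rat_mpoly_denominator v.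
exists (mpolyC n E * U), (mpolyC n D * V); split.
  rewrite rmorphM /= mcoeffC eqxx mulr1 mulf_neq0 //; apply/eqP => V0; apply: hv.
  apply/hmaxE/eqP; have /eqP : mcoeff mnm0 (v * mpolyC n E%:~R) = 0.
    by rewrite vE mcoeff_map_mpoly V0.
  by rewrite rmorphM /= mcoeffC eqxx mulr1 mulf_eq0 intr_eq0 (negPf E0) orbF.
rewrite !rmorphM /= -uE -vE !map_mpolyC !rmorphM /= -xE; ring.
Qed.

(** Fractions with numerator in the integral ideal and denominator of nonzero constant term form an
    ideal [K] containing the generators. Injectivity of the map to the local ring brings the
    equation back to integer polynomials. *)
Lemma int_ideal_clear_denominators n (B : set (mpoly n int)) f :
  int_ideal rat B (int_to_loc rat n f) ->
  exists2 h, mcoeff mnm0 h != 0 & ideal_gen B (h * f).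
Proof.
pose K := [set x | exists h g, [/\ mcoeff mnm0 h != 0, ideal_gen B g &
  x * int_to_loc rat n h = int_to_loc rat n g]].
have [B0 BD BM] := ideal_genP B.
have coeffM (u v : mpoly n int) :
    mcoeff mnm0 u != 0 -> mcoeff mnm0 v != 0 -> mcoeff mnm0 (u * v) != 0.
  by move=> u0 v0; rewrite rmorphM mulf_neq0.
have coeff1 : mcoeff mnm0 (1 : mpoly n int) != 0 by rewrite rmorph1 oner_neq0.
have KB : int_ideal rat B `<=` K.
  apply: ideal_gen_min => [|_ [g Bg <-]]; last first.
    by exists 1, g; split=> //;
      [apply: sub_ideal_gen|rewrite [int_to_loc _ _ 1]rmorph1 mulr1].
  split=> [|x y [h [g [h0 Bg xE]]] [h' [g' [h0' Bg' yE]]]|s x [h [g [h0 Bg xE]]]].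
  - by exists 1, 0; rewrite mul0r rmorph0.
  - exists (h * h'), (h' * g + h * g'); split; first exact: coeffM.
      by apply: BD; apply: BM.
    by rewrite rmorphD !rmorphM -xE -yE; ring.
  - have [u [v [v0 sE]]] := loc_int_fraction s.
    exists (v * h), (u * g); split; [exact: coeffM|exact: BM|].
    by rewrite !rmorphM -xE -sE; ring.
move=> /KB[h [g [h0 Bg fE]]]; exists h => //; suff -> : h * f = g by [].
move: fE; rewrite -rmorphM mulrC => /poly_to_loc_inj /mpolyP e.
apply/mpolyP => m; apply/eqP; move/eqP: (e m).
by rewrite !mcoeff_map_mpoly eqr_int.
Qed.

(** The constant term of [h] survives modulo [p], so [h] becomes a unit and can be cancelled. *)
Lemma int_ideal_Fp n (B : set (mpoly n int)) f h p : prime p ->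
  mcoeff mnm0 h != 0 -> (`|mcoeff mnm0 h| < p)%N -> ideal_gen B (h * f) ->
  int_ideal 'F_p B (int_to_loc 'F_p n f).
Proof.
move=> p_prime h0 hp Bhf.
have [|w wh] := @poly_to_loc_unit 'F_p n (map_mpoly intr h).
  move/hmax_map_intr/eqP; rewrite -(dvdz_pcharf (pchar_Fp p_prime)) dvdzE /=.
  by move/dvdn_leq; rewrite absz_gt0 h0 => /(_ isT); rewrite leqNgt hp.
have [_ _ BM] := ideal_genP (int_to_loc 'F_p n @` B).
rewrite -[int_to_loc _ _ f]mul1r -wh -mulrA; apply: (BM w).
rewrite -[poly_to_loc _]/(int_to_loc 'F_p n h) -rmorphM.
apply: (ideal_gen_morph (A := B)) Bhf => g Bg.
by apply: sub_ideal_gen; exists g.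
Qed.

(** Finitely many generators of [A] need finitely many multipliers [h], so only finitely many primes
    are lost. *)
Lemma int_ideal_reduction_sub n (A B : set (mpoly n int)) :
  int_ideal rat A `<=` int_ideal rat B ->
  exists M, forall p, prime p -> (M <= p)%N -> int_ideal 'F_p A `<=` int_ideal 'F_p B.
Proof.
move=> AB; have [s sA As] := noetherian_generators A (@noetherian_mpoly _ n noetherian_int).
suff [M MP] : exists M, forall p, prime p -> (M <= p)%N ->
    forall f, f \in s -> int_ideal 'F_p B (int_to_loc 'F_p n f).
  exists M => p p_prime /(MP p p_prime) sB.
  rewrite (int_ideal_generators _ sA As); apply: ideal_gen_min.
    exact: ideal_genP.
  by move=> _ [i _ <-]; apply: sB; apply: mem_nth.
elim: s sA {As} => [|f s IHs] fsA; first by exists 0%N.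
have [|M MP] := IHs; first by move=> g gs; apply: fsA;
  rewrite /= inE [g \in s]gs orbT.
have [|h h0 Bhf] := @int_ideal_clear_denominators n B f.
  by apply: AB; apply: sub_ideal_gen; exists f => //; apply: fsA;
    rewrite /= inE eqxx.
exists (maxn M `|mcoeff mnm0 h|.+1) => p p_prime.
rewrite geq_max => /andP[Mp hp] g; rewrite inE => /orP[/eqP ->|]; last exact: MP.
exact: int_ideal_Fp h0 hp Bhf.
Qed.

(** * Passage to the limit over the primes *)

Lemma pchar_local_ring_Fp n p : prime p -> p \in [pchar (local_ring 'F_p n)].
Proof.
move=> /pchar_Fp; exact: (rmorph_pchar ((@poly_to_loc 'F_p n) \o @mpolyC n 'F_p)).
Qed.

Theorem theorem6p4 (R : realType) (n : nat) (a b : set (local_ring rat n))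
    (A B : set (mpoly n int)) (lambda : R) :
  is_ideal a -> is_ideal b ->
  a <> [set 0] -> a <> setT -> b <> [set 0] -> b <> setT ->
  a `<=` b ->
  a = int_ideal rat A -> b = int_ideal rat B ->
  Fthreshold_mod R A B p @[p --> primes_oo] --> lambda ->
  (1 < lambda -> \forall p \near primes_oo, crit_mod R A B p = 1) /\
  (lambda <= 1 -> crit_mod R A B p @[p --> primes_oo] --> lambda).
Proof.
move=> _ _ _ _ _ bT ab aE bE Fcvg.
have [s sA As] := noetherian_generators A (@noetherian_mpoly _ n noetherian_int).
have FF : Filter primes_oo by apply: within_filter.
have primes_ge M : \forall p \near primes_oo, (M <= p)%N.
  by exists M => // p.
have primes_prime : \forall p \near primes_oo, prime p.
  by exists 0%N => // p.
have [M MP] : exists M, forall p, prime p -> (M <= p)%N ->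
    int_ideal 'F_p A `<=` int_ideal 'F_p B.
  by apply: int_ideal_reduction_sub; rewrite -aE -bE.
(* The bounds for a fixed prime hold for all large [p] with the same number [size s] of
   generators. *)
have bounds : \forall p \near primes_oo,
    [/\ crit_mod R A B p <= Fthreshold_mod R A B p, crit_mod R A B p <= 1 &
      1 <= crit_mod R A B p \/
      Fthreshold_mod R A B p - (size s)%:R / (p.-1)%:R <= crit_mod R A B p].
  near=> p; have p_prime : prime p by near: p.
  have AB : int_ideal 'F_p A `<=` int_ideal 'F_p B by apply: MP => //; near: p.
  have B1 : ~ int_ideal 'F_p B 1.
    by apply: int_ideal_proper; apply: int_ideal_coeff0; rewrite -bE.
  have charp := pchar_local_ring_Fp n p_prime.
  have B_ideal := ideal_genP ((int_to_loc 'F_p n) @` B).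
  rewrite /crit_mod /Fthreshold_mod; move: AB.
  rewrite (int_ideal_generators 'F_p sA As) => AB.
  split; [exact: crit_le_Fthreshold|exact: crit_le1|exact: crit_ge].
have error_small (e : R) : 0 < e ->
    \forall p \near primes_oo, (size s)%:R / (p.-1)%:R < e.
  move=> e0; near=> p; have p_prime : prime p by near: p.
  have p1 : 0 < p.-1%:R :> R by rewrite ltr0n -ltnS prednK ?prime_gt0 ?prime_gt1.
  rewrite ltr_pdivrMr // -ltr_pdivrMl // mulrC.
  have : (Num.bound ((size s)%:R / e : R) < p)%N by near: p; apply: primes_ge.
  rewrite -[X in (_ < X)%N](prednK (prime_gt0 p_prime)) ltnS -(ler_nat R).
  by apply: lt_le_trans; apply: archi_boundP; rewrite divr_ge0 // ltW.
split=> [lambda1|lambda1].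
  near=> p; have [_ le1 [ge1|]] : [/\ crit_mod R A B p <= Fthreshold_mod R A B p,
      crit_mod R A B p <= 1 & 1 <= crit_mod R A B p \/
      Fthreshold_mod R A B p - (size s)%:R / (p.-1)%:R <= crit_mod R A B p]
    by near: p.
    by apply/le_anti; rewrite le1.
  (* The two midpoint bounds give [c - N / (p - 1) > 1], so the second alternative contradicts
     [crit <= 1]. *)
  have : (1 + lambda) / 2 < Fthreshold_mod R A B p.
    by near: p; apply: (cvgr_gt _ Fcvg); lra.
  have : (size s)%:R / (p.-1)%:R < (lambda - 1) / 2.
    by near: p; apply: error_small; lra.
  lra.
(* Half of [e] covers the distance from [lambda] to the F-threshold and half the error term. If crit
   is at least 1, the lower estimate follows from [lambda <= 1]. *)
apply/cvgrPdist_lt => e e0; near=> p.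
have [le_c le1 ge_c] : [/\ crit_mod R A B p <= Fthreshold_mod R A B p,
      crit_mod R A B p <= 1 & 1 <= crit_mod R A B p \/
      Fthreshold_mod R A B p - (size s)%:R / (p.-1)%:R <= crit_mod R A B p]
  by near: p.
have : `|lambda - Fthreshold_mod R A B p| < e / 2.
  by near: p; move/cvgrPdist_lt: Fcvg; apply; lra.
have : (size s)%:R / (p.-1)%:R < e / 2 by near: p; apply: error_small; lra.
rewrite !ltr_norml => small /andP[c1 c2]; apply/andP; split; first lra.
by case: ge_c => ge_c; lra.
Unshelve. all: by end_near. Qed.
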